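(* Let $A\in\mathbb{R}^{d\times d}$ be symmetric. Suppose the Noisy Power Method is run on $A$ for $L\le d$ steps with dimension $p\le d$, with $X_0$ the Gram–Schmidt orthonormalization of a matrix with i.i.d. $N(0,1)$ entries, and with each $G_\ell$ sampled independently from $N(0,\sigma_\ell^2)^{d\times p}$ for some $\sigma_\ell>0$. Then with probability $1-1/d$, \[\max_{\ell=1}^L\|X_\ell\|_\infty^2\le O\!\left(\frac{\mu(A)\log d}{d}\right).\]
   Context: Noisy Power Method: for $\ell=1,\dots,L$, $Y_\ell=AX_{\ell-1}+G_\ell$ and $X_\ell$ is the orthonormal factor of the QR-factorization (Gram–Schmidt) of $Y_\ell$. $\|X\|_\infty=\max_{i,j}|X_{ij}|$. Coherence: for $A$ with singular value decomposition $A=U\Sigma V^\top$ ($A\in\mathbb{R}^{d\times d'}$), $\mu(A)=\max\{d\|U\|_\infty^2,d'\|V\|_\infty^2\}$. *)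

(* Defs.v *)
From HB Require Import structures.
From mathcomp Require Import all_boot all_order all_algebra.
From mathcomp Require Import all_classical all_reals all_analysis.

Set Implicit Arguments.
Unset Strict Implicit.
Unset Printing Implicit Defensive.

Import Order.TTheory GRing.Theory Num.Theory.
Import numFieldNormedType.Exports.

Local Open Scope classical_set_scope.
Local Open Scope ring_scope.

Definition dotv (R : realType) (d : nat) (u v : 'cV[R]_d) : R :=
  \sum_i u i 0 * v i 0.

(* The norm `|v| that MathComp-Analysis puts on matrices is the sup norm of the
   entries, so the Euclidean norm has to be introduced separately. *)
Definition norm2 (R : realType) (d : nat) (v : 'cV[R]_d) : R :=
  Num.sqrt (dotv v v).

(* Since 0^-1 = 0, a vector in the span of s contributes a zero vector; for
   linearly independent inputs this case does not occur. *)
Definition gs_step (R : realType) (d : nat) (s : seq 'cV[R]_d) (y : 'cV[R]_d) :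
    seq 'cV[R]_d :=
  let r := y - \sum_(x <- s) dotv x y *: x in rcons s ((norm2 r)^-1 *: r).

(* The orthonormal factor Q of the QR-factorization Y = Q R (R upper triangular
   with positive diagonal), the columns being processed from left to right. *)
Definition gram_schmidt (R : realType) (d p : nat) (Y : 'M[R]_(d, p)) :
    'M[R]_(d, p) :=
  \matrix_(i, j)
    (nth 0 (foldl (@gs_step R d) [::] [seq col k Y | k <- enum 'I_p]) j) i 0.

(* The noise of step l is G l, for l >= 1; the value G 0 is not used. *)
Fixpoint noisy_power (R : realType) (d p : nat) (A : 'M[R]_d)
    (X0 : 'M[R]_(d, p)) (G : nat -> 'M[R]_(d, p)) (l : nat) : 'M[R]_(d, p) :=
  if l is k.+1 then gram_schmidt (A *m noisy_power A X0 G k + G l) else X0.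

Definition orthogonal_mx (R : realType) (n : nat) (U : 'M[R]_n) : Prop :=
  U^T *m U = 1%:M.

(* Full singular value decomposition, with square orthogonal factors.  The
   singular values need not be sorted: permuting them permutes the columns of U
   and V, which does not affect the coherence. *)
Definition is_svd (R : realType) (d d' : nat) (A : 'M[R]_(d, d'))
    (U : 'M[R]_d) (S : 'M[R]_(d, d')) (V : 'M[R]_d') : Prop :=
  [/\ orthogonal_mx U, orthogonal_mx V,
      (forall i j, 0 <= S i j),
      (forall (i : 'I_d) (j : 'I_d'), i != j :> nat -> S i j = 0)
    & A = U *m S *m V^T].

(* Here `|U| is the largest absolute value of an entry of U. *)
Definition coherence (R : realType) (d d' : nat) (U : 'M[R]_d) (V : 'M[R]_d') :
    R :=
  Num.max (d%:R * `|U| ^+ 2) (d'%:R * `|V| ^+ 2).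

(* The product is taken in R through fine, which is harmless because
   probabilities are finite. *)
Definition mutually_independent (R : realType) (disp : measure_display)
    (T : measurableType disp) (P : probability T R) (I : finType)
    (X : I -> {RV P >-> R}) : Prop :=
  forall (J : {set I}) (B : I -> set R),
    (forall i, i \in J -> measurable (B i)) ->
    P [set w | forall i, i \in J -> B i (X i w)] =
    (\prod_(i in J) fine (P (X i @^-1` B i)))%:E.

(* s is the standard deviation, the parameter used by normal_prob. *)
Definition normal_rv (R : realType) (disp : measure_display)
    (T : measurableType disp) (P : probability T R) (m s : R)
    (X : {RV P >-> R}) : Prop :=
  forall B : set R, measurable B -> distribution P X B = normal_prob m s B.

(* All the Gaussian entries used by L steps, as one finite family: the entries
   W i j of the initial matrix at index 0 and those of the noise matrix G l at
   index l for 1 <= l <= L. *)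
Definition gaussian_family (R : realType) (disp : measure_display)
    (T : measurableType disp) (P : probability T R) (d p L : nat)
    (W : 'I_d -> 'I_p -> {RV P >-> R})
    (G : nat -> 'I_d -> 'I_p -> {RV P >-> R})
    (k : 'I_L.+1 * 'I_d * 'I_p) : {RV P >-> R} :=
  let: (l, i, j) := k in if (l : nat) == 0%N then W i j else G l i j.

Definition sample_mx (R : realType) (disp : measure_display)
    (T : measurableType disp) (P : probability T R) (d p : nat)
    (W : 'I_d -> 'I_p -> {RV P >-> R}) (w : T) : 'M[R]_(d, p) :=
  \matrix_(i, j) W i j w.

(* Main.v *)
Require Import Defs.
From HB Require Import structures.
From mathcomp Require Import all_boot all_order all_algebra.
From mathcomp Require Import all_classical all_reals all_analysis.
From mathcomp Require Import measurable_realfun ring lra.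

(* For a diagonal sign matrix D put Q_U = U D U^T and Q_V = V D V^T.  Since
   A = U S V^T = V S U^T with S diagonal, Q_U A = A Q_V and Q_V A = A Q_U.
   Multiplying the initial matrix and the noise matrices alternately by Q_U and
   Q_V does not change their Gaussian law, and turns X_l into Q_U X_l (the
   parity being chosen so that Q_U comes last).  So X_l and Q_U X_l have the
   same law for every choice of signs e, and
     (Q_U X_l)_ij = \sum_k e_k U_ik (U^T X_l)_kj
   is a Rademacher sum whose variance is at most `|U| ^+ 2.  Averaging over the
   signs gives a sub-Gaussian tail for each entry, and a union bound over the at
   most d ^ 3 triples (l, i, j) concludes.  U need not be an eigenbasis of A, so
   A need not commute with Q_U; this is why Q_U and Q_V have to alternate.

   Rotation invariance of the Gaussian law is only needed for Householder
   reflections, which are conjugates of reflections of a coordinate plane; for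
   those it follows from Tonelli and one-dimensional affine substitutions. *)

Set Implicit Arguments.
Unset Strict Implicit.
Unset Printing Implicit Defensive.

Import Order.TTheory GRing.Theory Num.Theory.
Import numFieldNormedType.Exports.

Local Open Scope classical_set_scope.
Local Open Scope ring_scope.

(** * Reflections of the plane and Gaussian measures *)

(** Gives the pushforward as a bundled measure, to which the uniqueness theorems for measures
    apply. *)
Lemma pushforward_is_measure d d' (T1 : measurableType d)
    (T2 : measurableType d') (R : realType) (m : {measure set T1 -> \bar R})
    (f : T1 -> T2) :
  measurable_fun setT f ->
  exists m' : {measure set T2 -> \bar R},
    m' = pushforward m f :> (set T2 -> \bar R).
Proof.
by move=> mf; unshelve eexists (pushforward m f).
Qed.

Section affine.
Context {R : realType}.
Notation mu := (@lebesgue_measure R).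

Lemma measurable_affine (a b : R) :
  measurable_fun [set: measurableTypeR R]
    (fun x => (a * x + b)%R : measurableTypeR R).
Proof.
by apply: measurable_funD => //; apply: measurable_funM.
Qed.

(** By uniqueness of Lebesgue measure, it suffices to compare lengths on half-open intervals. *)
Lemma lebesgue_measure_affine (a b : R) (A : set (measurableTypeR R)) :
  a != 0 -> measurable A ->
  (`|a|%:E * pushforward mu (fun x => (a * x + b)%R : measurableTypeR R) A)%E =
  mu A.
Proof.
move=> a0 mA; apply/esym.
have mf := measurable_affine a b.
have [m mE] := pushforward_is_measure mu mf.
have -> : (`|a|%:E * pushforward mu (fun x => (a * x + b)%R : measurableTypeR
  R) A)%E = mscale `|a|%:nng m A.
  by rewrite /mscale/= mE.
apply: lebesgue_measure_unique => // _ [[x y]] _ <-.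
rewrite /= /mscale /= mE /pushforward /=.
have [a_lt0|a_gt0|/eqP] := ltgtP a 0; last by rewrite (negbTE a0).
(* For [a < 0] the preimage is half-open at the opposite end, which does not affect its length. *)
- have -> : (fun x0 => a * x0 + b) @^-1` `]x, y] = `[(y - b) / a,
  (x - b) / a[%classic.
    apply/seteqP; split => z; rewrite /= !in_itv /= ler_ndivrMr// ltr_ndivlMr//
      lerBrDr ltrBlDr !(mulrC z); lra.
  rewrite !lebesgue_measure_itv /= !lte_fin ltr_ndivrMr// mulfVK// ltrD2r.
  case: ifP => _; last by rewrite mule0.
  rewrite -EFinB -EFinM; congr EFin; rewrite ltr0_norm//; field.
  by [].
- have -> : (fun x0 => a * x0 + b) @^-1` `]x, y] = `](x - b) / a,
  (y - b) / a]%classic.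
    apply/seteqP; split => z; rewrite /= !in_itv /= ler_pdivlMr// ltr_pdivrMr//
      lerBrDr ltrBlDr !(mulrC z); lra.
  rewrite !lebesgue_measure_itv /= !lte_fin ltr_pdivrMr// mulfVK// ltrD2r.
  case: ifP => _; last by rewrite mule0.
  rewrite -EFinB -EFinM; congr EFin; rewrite gtr0_norm//; field.
  by [].
Qed.

Lemma ge0_integral_affine (a b : R) (f : measurableTypeR R -> \bar R) :
  a != 0 -> measurable_fun setT f -> (forall x, 0 <= f x)%E ->
  (\int[mu]_x f x = `|a|%:E * \int[mu]_x f (a * x + b)%R)%E.
Proof.
move=> a0 mf f0.
have mg := measurable_affine a b.
have [m mE] := pushforward_is_measure mu mg.
transitivity (\int[mscale (`|a|%:nng)%R m]_x f x)%E.
  by apply: eq_measure_integral => A mA _; rewrite /= /mscale/= mE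
    lebesgue_measure_affine.
rewrite ge0_integral_mscale//; congr (_ * _)%E.
rewrite mE ge0_integral_pushforward//.
Qed.
End affine.

Lemma density_is_measure d (T : measurableType d) (R : realType)
    (m : {measure set T -> \bar R}) (g : T -> \bar R) :
  measurable_fun setT g -> (forall x, 0 <= g x)%E ->
  exists m' : {measure set T -> \bar R},
    m' = (fun A => \int[m]_(x in A) g x)%E :> (set T -> \bar R).
Proof.
move=> mg g0; pose f (A : set T) : \bar R := (\int[m]_(x in A) g x)%E.
have f_0 : f set0 = 0%E by rewrite /f integral_set0.
have f_ge0 A : (0 <= f A)%E by apply: integral_ge0.
have f_add : semi_sigma_additive f.
  move=> /= A mA tA mUA; rewrite /f ge0_integral_bigcup//.
  - by apply: is_cvg_ereal_nneg_natsum_cond => n _ _; exact: f_ge0.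
  - exact: measurable_funTS.
pose f' : {measure set T -> \bar R} := HB.pack f (isMeasure.Build _ _ _ f f_0
  f_ge0 f_add).
by exists f'.
Qed.

Section planar.
Context {R : realType}.
Notation mu := (@lebesgue_measure R).
Local Notation RT := (measurableTypeR R).

Lemma ge0_integral_reflection (c s : R) (h : RT * RT -> \bar R) :
  c ^+ 2 + s ^+ 2 = 1 -> measurable_fun setT h -> (forall z, 0 <= h z)%E ->
  (\int[mu]_x \int[mu]_y h (c * x + s * y, s * x - c * y)%R =
   \int[mu]_u \int[mu]_v h (u, v))%E.
Proof.
move=> cs1 mh h0.
have mF (f1 f2 : RT * RT -> RT) : measurable_fun setT f1 ->
  measurable_fun setT f2 ->
    measurable_fun setT (fun z => h (f1 z, f2 z)).
  by move=> mf1 mf2; apply: measurableT_comp => //; exact/measurable_fun_pair.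
have mF1 (f1 f2 : RT -> RT) : measurable_fun setT f1 ->
  measurable_fun setT f2 ->
    measurable_fun setT (fun z => h (f1 z, f2 z)).
  by move=> mf1 mf2; apply: measurableT_comp => //; exact/measurable_fun_pair.
(* The general substitution divides by [s]. For [s = 0], [c] is a sign and the two variables are
   substituted separately. *)
have [s0|s0] := eqVneq s 0.
  have c0 : c != 0 by apply: contra_eq_neq cs1 => ->;
    rewrite s0 expr0n addr0 eq_sym oner_eq0.
  have c1 : `|c| = 1.
    by apply/eqP; rewrite -(@pexpr_eq1 _ _ 2)// real_normK ?num_real// -cs1 s0
      expr0n addr0.
  rewrite (@ge0_integral_affine _ c 0 (fun u => \int[mu]_v h (u, v))%E)//;
    last 2 first.
  - by apply: (@measurable_fun_fubini_tonelli_F _ _ _ _ _ mu h).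
  - by move=> x; exact: integral_ge0.
  rewrite c1 mul1e; apply: eq_integral => x _.
  rewrite [RHS](@ge0_integral_affine _ (- c) 0) ?oppr_eq0//; last first.
    by apply: mF1 => //.
  rewrite normrN c1 mul1e; apply: eq_integral => y _.
  by rewrite s0 !mul0r add0r !addr0 mulNr.
(* Substitute u = c x + s y for y at fixed x and then, after Tonelli,
   v = (x - c u) / s for x at fixed u; then x = c u + s v and y = s u - c v. *)
transitivity (\int[mu]_x (`|s^-1|%:E * \int[mu]_u h (u, (x - c * u) / s)%R))%E.
  apply: eq_integral => x _.
  rewrite (@ge0_integral_affine _ s^-1 (- (c * x) / s)) ?invr_eq0//; last first.
    by apply: mF1 => //; [exact: measurable_funD|exact: measurable_funB].
  congr (_ * _)%E; apply: eq_integral => u _; congr h; congr pair.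
    by field.
  apply: (mulIf s0); rewrite -[RHS]mulrA mulVf// mulr1.
  rewrite (_ : (s * x - c * (s^-1 * u + - (c * x) / s)) * s = (c ^+ 2 + s ^+ 2)
    * x - c * u); last by field.
  by rewrite cs1 mul1r.
have mk : measurable_fun setT (fun z : RT * RT => h (z.2, (z.1 - c * z.2) / s)).
  apply: mF => //; apply: measurable_funM => //; apply: measurable_funB => //.
  exact: measurable_funM.
rewrite ge0_integralZl//; last 2 first.
- exact: (@measurable_fun_fubini_tonelli_F _ _ _ _ _ mu _ mk).
- by move=> x _; exact: integral_ge0.
rewrite (@fubini_tonelli _ _ _ _ _ mu mu _ mk)//.
rewrite -ge0_integralZl//; last 2 first.
- exact: (@measurable_fun_fubini_tonelli_G _ _ _ _ _ mu _ mk).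
- by move=> x _; exact: integral_ge0.
apply: eq_integral => u _.
rewrite /fubini_G/= (@ge0_integral_affine _ s (c * u))//; last first.
  by apply: mF1 => //; apply: measurable_funM => //; exact: measurable_funB.
rewrite muleA -EFinM -normrM mulVf// normr1 mul1e.
by apply: eq_integral => v _; rewrite addrK mulrAC mulfV// mul1r.
Qed.
End planar.

Section planar_normal.
Context {R : realType}.
Notation mu := (@lebesgue_measure R).
Local Notation RT := (measurableTypeR R).
Variable sigma : R.
Local Notation N := (normal_prob 0 sigma).
Local Notation pdf := (normal_pdf 0 sigma).

(** The double integral is a measure in [S], so uniqueness of the product measure reduces the
    equality to rectangles, where the integrand factors. *)
Lemma product_normal_probE (S : set (RT * RT)) : measurable S ->
  ((N \x N) S = \int[mu]_x \int[mu]_y (\1_S (x, y) * (pdf x * pdf y))%:E)%E.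
Proof.
move=> mS; pose g (z : RT * RT) := (pdf z.1 * pdf z.2)%:E.
have mpdf := @measurable_normal_pdf R 0 sigma.
have mg : measurable_fun setT g.
  by apply/measurable_EFinP; apply: measurable_funM => /=;
    apply: measurableT_comp.
have g0 z : (0 <= g z)%E by rewrite lee_fin mulr_ge0 ?normal_pdf_ge0.
have [m mE] := density_is_measure (mu \x mu)%E mg g0.
have mEE A : measurable A -> (m A = \int[mu]_x \int[mu]_y (\1_A (x,
  y) * (pdf x * pdf y))%:E)%E.
  move=> mA; rewrite mE integral_mkcond fubini_tonelli1.
  - apply: eq_integral => x _; apply: eq_integral => y _.
    by rewrite patchE indicE; case: ifP => _ /=; rewrite ?mul1r ?mul0r.
  - apply/(measurable_restrictT _ mA); exact: measurable_funTS.
  - by move=> z; rewrite patchE; case: ifP.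
rewrite -mEE//; apply: product_measure_unique => // A B mA mB.
rewrite mEE//; last exact: measurableX.
rewrite /= /normal_prob [X in (X * _)%E]integral_mkcond -ge0_integralZr//;
  last 3 first.
- apply/(measurable_restrictT _ mA); apply/measurable_funTS/measurable_EFinP;
  exact: mpdf.
- by move=> x _; rewrite patchE; case: ifP => // _;
  rewrite lee_fin normal_pdf_ge0.
- by apply: integral_ge0 => x _; rewrite lee_fin normal_pdf_ge0.
apply: eq_integral => x _.
rewrite patchE; case: ifPn => xA; last first.
  rewrite mul0e integral0_eq// => y _; rewrite indicE.
  by rewrite [_ \in _](_ : _ = false) ?mul0r//; apply/negbTE; apply: contra xA;
    rewrite !inE => -[].
rewrite [X in (_ * X)%E]integral_mkcond -ge0_integralZl//; last 3 first.
- apply/(measurable_restrictT _ mB); apply/measurable_funTS/measurable_EFinP;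
  exact: mpdf.
- by move=> y _; rewrite patchE; case: ifP => // _;
  rewrite lee_fin normal_pdf_ge0.
- by rewrite lee_fin normal_pdf_ge0.
apply: eq_integral => y _; rewrite patchE indicE.
rewrite [(x, y) \in _](_ : _ = (y \in B)); last first.
  by apply/idP/idP => [/set_mem[_ /mem_set]//|/set_mem By]; apply/mem_set;
    split => //=; exact: set_mem.
by case: ifP => _; rewrite ?mul1r ?mul0r ?mule0.
Qed.

Lemma product_normal_prob_reflection (c s : R) (A B : set RT) :
  sigma != 0 -> c ^+ 2 + s ^+ 2 = 1 -> measurable A -> measurable B ->
  ((N \x N) [set z : RT * RT | A (c * z.1 + s * z.2)%R /\ B (s * z.1 - c *
    z.2)%R] =
   N A * N B)%E.
Proof.
move=> sigma0 cs1 mA mB.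
have mf1 : measurable_fun setT (fun z : RT * RT => c * z.1 + s * z.2 : RT).
  by apply: measurable_funD => //; apply: measurable_funM.
have mf2 : measurable_fun setT (fun z : RT * RT => s * z.1 - c * z.2 : RT).
  by apply: measurable_funB => //; apply: measurable_funM.
have mf : measurable_fun setT (fun z : RT * RT => (c * z.1 + s * z.2 : RT,
  s * z.1 - c * z.2 : RT)).
  exact/measurable_fun_pair.
have mAB : measurable (A `*` B) by exact: measurableX.
have -> : [set z : RT * RT | A (c * z.1 + s * z.2)%R /\ B (s * z.1 - c *
  z.2)%R] =
   (fun z : RT * RT => (c * z.1 + s * z.2 : RT,
     s * z.1 - c * z.2 : RT)) @^-1` (A `*` B) by [].
rewrite product_normal_probE; last by rewrite -[X in measurable X]setTI;
  exact: mf.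
transitivity ((N \x N) (A `*` B))%E; last by rewrite product_measure1E.
pose h (z : RT * RT) := (\1_(A `*` B) z * (pdf z.1 * pdf z.2))%:E.
have mpdf := @measurable_normal_pdf R 0 sigma.
have mh : measurable_fun setT h.
  apply/measurable_EFinP; apply: measurable_funM => //.
  by apply: measurable_funM => //; apply: measurableT_comp.
have h0 z : (0 <= h z)%E by rewrite lee_fin !mulr_ge0 ?normal_pdf_ge0.
rewrite [RHS](product_normal_probE mAB).
transitivity (\int[mu]_x \int[mu]_y h (c * x + s * y, s * x - c * y)%R)%E;
  last first.
  exact: (ge0_integral_reflection cs1 mh h0).
apply: eq_integral => x _; apply: eq_integral => y _; rewrite /h/=; congr EFin.
(* The product of the two densities depends only on the sum of the squares, which the reflection
   preserves. *)
congr (_ * _); rewrite !normal_pdfE// /normal_fun !subr0.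
rewrite mulrACA [RHS]mulrACA -!expRD; congr (_ * expR _).
rewrite -!mulrDl -!opprD; congr (- _ * _).
rewrite -[LHS]mul1r -cs1; ring.
Qed.
End planar_normal.

(** * Orthogonal invariance of Gaussian families *)

Section gaussian_law.
Context {R : realType} {disp : measure_display} {T : measurableType disp}.
Variable P : probability T R.
Local Notation RT := (measurableTypeR R).

(** Boxes over the whole index set suffice to express independence: [setT] is allowed on the
    coordinates left free. *)
Definition gaussian_law (I : finType) (s : I -> R) (Z : I -> T -> RT) : Prop :=
  (forall i, measurable_fun setT (Z i)) /\
  forall B : I -> set RT, (forall i, measurable (B i)) ->
    P [set w | forall i, B i (Z i w)] =
    (\prod_i fine (normal_prob 0 (s i) (B i)))%:E.

Lemma measurable_forall (I : finType) (Z : I -> T -> RT) (B : I -> set RT) :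
  (forall i, measurable_fun setT (Z i)) -> (forall i, measurable (B i)) ->
  measurable [set w | forall i, B i (Z i w)].
Proof.
move=> mZ mB.
have -> : [set w | forall i, B i (Z i w)] = \bigcap_(i in [set: I]) (Z i @^-1`
  B i).
  by apply/seteqP; split => w /= Bw i; [move=> _; exact: Bw|exact: Bw].
apply: fin_bigcap_measurable; first exact: finite_finset.
by move=> i _; rewrite -[X in measurable X]setTI; exact: mZ.
Qed.

Lemma gaussian_law_reflection (I : finType) (s : I -> R) (Z : I -> T -> RT)
    (a b : I) (c t : R) :
  a != b -> s a = s b -> s a != 0 -> c ^+ 2 + t ^+ 2 = 1 ->
  gaussian_law s Z ->
  gaussian_law s (fun i w =>
    if i == a then c * Z a w + t * Z b w
    else if i == b then t * Z a w - c * Z b w else Z i w : RT).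
Proof.
move=> ab sab sa0 ct1 [mZ PZ]; split=> [i|B mB].
  case: (i == a).
    by apply: measurable_funD; apply: measurable_funM;
      do ?exact: measurable_cst; exact: mZ.
  case: (i == b); last exact: mZ.
  by apply: measurable_funB; apply: measurable_funM; do ?exact: measurable_cst;
    exact: mZ.
(* On the event constraining the other coordinates, the law of (Z a, Z b) is a
   multiple of a product of two centered Gaussians with equal variances. *)
pose Bs (A A' : set RT) i := if i == a then A else if i == b then A' else B i.
have mBs A A' : measurable A -> measurable A' -> forall i,
  measurable (Bs A A' i).
  by move=> mA mA' i; rewrite /Bs; case: ifP => // _; case: ifP => // _;
    exact: mB.
pose E := [set w | forall i, Bs setT setT i (Z i w)].
have mE : measurable E by apply: measurable_forall => //; exact: mBs.
have mpair : measurable_fun setT (fun w => (Z a w : RT,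
  Z b w : RT)) by exact/measurable_fun_pair.
have [nu nuE] := pushforward_is_measure (mrestr P mE) mpair.
pose k : R := \prod_(i | (i != a) && (i != b)) fine (normal_prob 0 (s i) (B i)).
have k0 : 0 <= k by apply: prodr_ge0 => i _; exact: fine_ge0.
pose N : probability RT R := normal_prob 0 (s a).
have prodE A A' : \prod_i fine (normal_prob 0 (s i) (Bs A A' i)) = k * (fine (N
  A) * fine (N A')).
  rewrite (bigD1 a)//= (bigD1 b)/=; last by rewrite eq_sym.
  rewrite /Bs eqxx (negbTE (_ : b != a)) 1?eq_sym// eqxx -sab mulrA mulrC;
    congr (_ * _).
  apply: eq_bigr => i /andP[/negbTE-> /negbTE->] //.
have nuX (A A' : set RT) : measurable A -> measurable A' ->
    (nu (A `*` A') = mscale (NngNum k0) N A * N A')%E.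
  move=> mA mA'; transitivity (P [set w | forall i, Bs A A' i (Z i w)]).
    rewrite nuE; congr (P _); apply/seteqP; split => w /=.
      move=> [[/= Aw Aw'] Ew] i; have := Ew i; rewrite /Bs.
      by case: eqVneq => [->//|_]; case: eqVneq => [->//|_].
    move=> Bw; split; last first.
      by move=> i; have := Bw i; rewrite /Bs; case: ifP => // _; case: ifP.
    by split => /=; [have := Bw a|have := Bw b];
      rewrite /Bs eqxx// eq_sym (negbTE ab).
  rewrite PZ; last exact: mBs.
  rewrite prodE /mscale/= -muleA !EFinM !fineK//; exact: fin_num_measure.
(* The event to be measured is a reflected box, not a rectangle in [(Z a, Z b)], so the product
   formula is first extended to all measurable sets. *)
have nuS S : measurable S -> (nu S = k%:E * (N \x N) S)%E.
  move=> mS; rewrite -(product_measure_unique nuX)// /product_measure1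
    ge0_integral_mscale//.
  exact: measurable_fun_xsection.
have mS : measurable [set z : RT * RT | B a (c * z.1 + t * z.2) /\ B b (t * z.1
  - c * z.2)].
  have -> : [set z : RT * RT | B a (c * z.1 + t * z.2) /\ B b (t * z.1 - c *
    z.2)] =
    (fun z : RT * RT => (c * z.1 + t * z.2 : RT,
      t * z.1 - c * z.2 : RT)) @^-1` (B a `*` B b) by [].
  rewrite -[X in measurable X]setTI.
  have mf : measurable_fun setT (fun z : RT * RT => (c * z.1 + t * z.2 : RT,
    t * z.1 - c * z.2 : RT)).
    by apply/measurable_fun_pair; [apply: measurable_funD|apply:
      measurable_funB] => //; apply: measurable_funM.
  by apply: mf => //; exact: measurableX.
transitivity (nu [set z : RT * RT | B a (c * z.1 + t * z.2) /\ B b (t * z.1 - c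
  * z.2)]).
  rewrite nuE; congr (P _); apply/seteqP; split => w /=.
    move=> Bw; split.
      by split => /=; [have := Bw a|have := Bw b];
        rewrite eqxx// eq_sym (negbTE ab).
    by move=> i; have := Bw i; rewrite /Bs; case: ifP => // _; case: ifP.
  move=> [[/= Aw Aw'] Ew] i; have := Ew i; rewrite /Bs.
  by case: eqVneq => [->//|_]; case: eqVneq => [->//|_].
rewrite nuS// product_normal_prob_reflection//.
rewrite (_ : \prod_i _ = \prod_i fine (normal_prob 0 (s i) (Bs (B a) (B b)
  i))); last first.
  by apply: eq_bigr => i _; rewrite /Bs; case: eqVneq => [->//|_];
    case: eqVneq => [->//|_].
by rewrite prodE !EFinM !fineK//; exact: fin_num_measure.
Qed.
End gaussian_law.

(** * Planar and Householder reflections, sign matrices *)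

Section reflection_matrices.
Context {R : realType} {d : nat}.
Implicit Types (u v : 'cV[R]_d) (a b : 'I_d) (c t : R).

(** A reflection rather than a rotation: for [a != b] and [c ^+ 2 + t ^+ 2 = 1] it is symmetric and
    its own inverse, so conjugation uses the same matrix on both sides. *)
Definition planar_mx a b c t : 'M[R]_d := \matrix_(i, j)
  if i == a then c * (j == a)%:R + t * (j == b)%:R
  else if i == b then t * (j == a)%:R - c * (j == b)%:R else (i == j)%:R.

Lemma sum_delta (f : 'I_d -> R) a : \sum_j (j == a)%:R * f j = f a.
Proof.
by rewrite (bigD1 a)//= eqxx mul1r big1 ?addr0// => j /negbTE ->; rewrite mul0r.
Qed.

Lemma planar_mulE a b c t (f : 'I_d -> R) i :
  \sum_j planar_mx a b c t i j * f j =
  if i == a then c * f a + t * f b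
  else if i == b then t * f a - c * f b else f i.
Proof.
under eq_bigr do rewrite mxE.
case: (i == a).
  under eq_bigr do rewrite mulrDl -!mulrA.
  by rewrite big_split/= -!mulr_sumr !sum_delta.
case: (i == b).
  under eq_bigr do rewrite mulrBl -!mulrA.
  by rewrite sumrB -!mulr_sumr !sum_delta.
by under eq_bigr do rewrite eq_sym; rewrite sum_delta.
Qed.

Lemma planar_mx_tr a b c t :
  a != b -> (planar_mx a b c t)^T = planar_mx a b c t.
Proof.
move=> /negbTE ab; have ba : (b == a) = false by rewrite eq_sym.
apply/matrixP => i j; rewrite !mxE (eq_sym j i).
have [->|/negbTE ia] := eqVneq i a.
  have [->//|/negbTE ja] := eqVneq j a.
  by rewrite ab; case: (j == b) => /=; ring.
have [->|/negbTE ja] := eqVneq j a.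
  by rewrite ?ab ?ia ?eqxx; case: (i == b) => /=; ring.
have [->|/negbTE ib] := eqVneq i b.
  by case: (eqVneq j b) => _ /=; ring.
case: (eqVneq j b) => [jb|//]; rewrite jb ib /=; ring.
Qed.

Lemma planar_mxK a b c t : a != b -> c ^+ 2 + t ^+ 2 = 1 ->
  planar_mx a b c t *m planar_mx a b c t = 1%:M.
Proof.
move=> ab ct; have ba : b != a by rewrite eq_sym.
apply/matrixP => i j; rewrite mxE planar_mulE !mxE !eqxx (negbTE ba).
case: (eqVneq i a) => [->|ia].
  rewrite (eq_sym a j); transitivity ((c ^+ 2 + t ^+ 2) * (j == a)%:R);
    first by ring.
  by rewrite ct mul1r.
case: (eqVneq i b) => [->|ib] //.
rewrite (eq_sym b j); transitivity ((c ^+ 2 + t ^+ 2) * (j == b)%:R);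
  first by ring.
by rewrite ct mul1r.
Qed.

Definition householder u : 'M[R]_d := 1%:M - 2 *: (u *m u^T).

Lemma householder_conj (M : 'M[R]_d) u : M^T = M -> M *m M = 1%:M ->
  householder u = M *m householder (M *m u) *m M.
Proof.
move=> MT MM; rewrite /householder mulmxBr mulmxBl mulmx1 MM; congr (_ - _).
rewrite -scalemxAr -scalemxAl trmx_mul MT !mulmxA MM mul1mx -!mulmxA MM
  mulmx1//.
Qed.

Lemma planar_elim u a b : u a 0 != 0 ->
  exists c t, c ^+ 2 + t ^+ 2 = 1 /\ t * u a 0 - c * u b 0 = 0.
Proof.
move=> ua0; pose r2 := u a 0 ^+ 2 + u b 0 ^+ 2.
have r20 : 0 < r2 by rewrite ltr_wpDr ?sqr_ge0// exprn_even_gt0.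
have r0 : Num.sqrt r2 != 0 by rewrite gt_eqF// sqrtr_gt0.
(* The unit vector along [(u a 0, u b 0)]: the reflection sends this pair to the first axis. *)
exists (u a 0 / Num.sqrt r2), (u b 0 / Num.sqrt r2); split; last by ring.
rewrite !expr_div_n -mulrDl sqr_sqrtr ?ltW// mulfV//; exact: lt0r_neq0.
Qed.

End reflection_matrices.

Section gaussian_columns.
Context {R : realType} {disp : measure_display} {T : measurableType disp}.
Variable P : probability T R.
Local Notation RT := (measurableTypeR R).
Variables (K : finType) (d : nat) (s : K -> R).
Hypothesis s_neq0 : forall k, s k != 0.

(** The index is a column and a coordinate in it. The scale depends on the column only, which makes
    each column rotation invariant. *)
Definition gaussian_columns (Z : K * 'I_d -> T -> RT) :=
  gaussian_law P (fun i => s i.1) Z.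

(** Quantifying over all families [Z] makes the property stable under matrix products. *)
Definition law_invariant (Q : 'M[R]_d) := forall Z k, gaussian_columns Z ->
  gaussian_columns (fun i w =>
    if i.1 == k then \sum_b Q i.2 b * Z (k, b) w else Z i w : RT).

Lemma law_invariant1 : law_invariant 1%:M.
Proof.
move=> Z k; congr gaussian_columns; apply/funext => -[k' i]; apply/funext =>
  w /=.
case: eqVneq => [->|//]; under eq_bigr do rewrite mxE eq_sym.
by rewrite sum_delta.
Qed.

Lemma law_invariantM Q1 Q2 : law_invariant Q1 -> law_invariant Q2 ->
  law_invariant (Q1 *m Q2).
Proof.
move=> q1 q2 Z k /(q2 Z k)/(q1 _ k); congr gaussian_columns.
apply/funext => -[k' i]; apply/funext => w /=.
case: eqVneq => [_|//]; rewrite eqxx.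
under eq_bigr do rewrite mulr_sumr.
rewrite exchange_big/=; apply: eq_bigr => j _.
by rewrite mxE mulr_suml; apply: eq_bigr => l _; rewrite mulrA.
Qed.

Lemma law_invariant_planar a b c t : a != b -> c ^+ 2 + t ^+ 2 = 1 ->
  law_invariant (planar_mx a b c t).
Proof.
move=> ab ct Z k ZG.
have kab : (k, a) != (k, b) :> K * 'I_d by rewrite xpair_eqE eqxx.
have := @gaussian_law_reflection _ _ _ P _ (fun i : K * 'I_d => s i.1) Z
  (k, a) (k, b) c t kab erefl (s_neq0 k) ct ZG.
congr gaussian_law.
apply/funext => -[k' i]; apply/funext => w /=.
rewrite !xpair_eqE; case: eqVneq => [->|//]/=.
by rewrite planar_mulE.
Qed.

Lemma law_invariant_householder u : (1 < d)%N -> u^T *m u = 1%:M ->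
  law_invariant (householder u).
Proof.
(* Induction on the support of u: the conjugation by a planar reflection removes
   one coordinate from it; a vector with a single nonzero entry is +-e_a, whose
   reflection is the planar one with c = -1 and t = 0. *)
move=> d1; have [n] := ubnP #|[pred i | u i 0 != 0]|.
elim: n => // n IH in u *; rewrite ltnS => un uu.
have uu1 : \sum_i u i 0 ^+ 2 = 1.
  transitivity ((u^T *m u) 0 0); last by rewrite uu mxE eqxx.
  by rewrite mxE; apply: eq_bigr => i _; rewrite mxE expr2.
have [|/card_le1P u1] := ltnP 1 #|[pred i | u i 0 != 0]|.
  move=> /card_gt1P[a [b [ua ub ab]]]; rewrite !inE in ua ub.
  have [c [t [ct tu]]] := planar_elim b ua.
  set M := planar_mx a b c t.
  have MT : M^T = M by exact: planar_mx_tr.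
  have MM : M *m M = 1%:M by exact: planar_mxK.
  rewrite (householder_conj u MT MM).
  apply: law_invariantM; last exact: law_invariant_planar.
  apply: law_invariantM; first exact: law_invariant_planar.
  have ME i : (M *m u) i 0 = if i == a then c * u a 0 + t * u b 0
      else if i == b then 0 else u i 0.
    by rewrite mxE (planar_mulE a b c t (fun j => u j 0)) tu.
  apply: IH; last by rewrite trmx_mul mulmxA -(mulmxA u^T) MT MM mulmx1.
  apply: leq_trans un; apply: proper_card; apply/properP; split.
    apply/fintype.subsetP => i; rewrite !inE ME.
    by case: ifP => [/eqP ->//|_]; case: ifP; rewrite ?eqxx.
  by exists b; rewrite !inE// ME (eq_sym b a) (negbTE ab) !eqxx.
have [a ua] : exists a, u a 0 != 0.
  apply/existsP; apply: contra_eqT uu1; rewrite negb_exists => /forallP u0.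
  rewrite big1 1?eq_sym ?oner_eq0// => i _.
  by have := u0 i; rewrite negbK => /eqP ->; rewrite expr0n.
have ui i : i != a -> u i 0 = 0.
  by move=> ia; apply: contraNeq ia => ui; have := u1 a ua i;
    rewrite !inE ui => /esym.
have ua1 : u a 0 * u a 0 = 1.
  by rewrite -expr2 -uu1 (bigD1 a)//= big1 ?addr0// => i /ui ->; rewrite expr0n.
(* Here [1 < d] enters: a planar matrix needs a second index [b], which it fixes when [c = -1] and
   [t = 0]. *)
have [b ab] : exists b, a != b.
  have /card_gt1P[x [y [_ _ xy]]] : (1 < #|'I_d|)%N by rewrite card_ord.
  by case: (eqVneq a x) => [->|]; [exists y|exists x].
suff -> : householder u = planar_mx a b (-1) 0.
  by apply: law_invariant_planar => //; rewrite sqrrN expr1n expr0n addr0.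
apply/matrixP => i j; rewrite !mxE big_ord1 !mxE !mul0r addr0 !mulN1r.
have [->|ia] := eqVneq i a.
  have [->|ja] := eqVneq j a; first by rewrite ua1/=; ring.
  by rewrite (ui j ja)/=; ring.
rewrite (ui i ia) mul0r mulr0 subr0.
by have [->|//] := eqVneq i b; rewrite sub0r opprK eq_sym.
Qed.

End gaussian_columns.

Section sign_matrices.
Context {R : realType} {disp : measure_display} {T : measurableType disp}.
Variable P : probability T R.
Local Notation RT := (measurableTypeR R).
Variables (K : finType) (d : nat) (s : K -> R).
Hypothesis s_neq0 : forall k, s k != 0.

Definition sign_mx (U : 'M[R]_d) (e : 'I_d -> bool) : 'M[R]_d :=
  U *m diag_mx (\row_k (-1) ^+ e k) *m U^T.

(** A diagonal matrix with a single -1, at [k], is [1 - 2 e_k e_k^T], and [U] sends [e_k] to its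
    column [k]. *)
Lemma householder_col (U : 'M[R]_d) k : orthogonal_mx U ->
  householder (col k U) = sign_mx U (fun j => j == k).
Proof.
move=> UU; have UU' := mulmx1C UU.
rewrite /householder /sign_mx.
have -> : diag_mx (\row_j (-1) ^+ (j == k)) = 1%:M - 2 *: ((delta_mx k 0 :
  'cV[R]_d) *m (delta_mx k 0)^T).
  rewrite trmx_delta mul_delta_mx; apply/matrixP => i j; rewrite !mxE.
  case: (eqVneq i j) => [->|ij].
    by case: (eqVneq j k) => _ /=; rewrite ?expr1 ?expr0; ring.
  rewrite mulr0n; case: (eqVneq i k) => [ik|_] /=; last by rewrite mulr0 subr0.
  by rewrite -ik eq_sym (negbTE ij) mulr0 subr0.
rewrite mulmxBr mulmxBl mulmx1 UU' -scalemxAr -scalemxAl colE trmx_mul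
  !mulmxA//.
Qed.

Lemma sign_mxM (U : 'M[R]_d) e f : orthogonal_mx U ->
  sign_mx U e *m sign_mx U f = sign_mx U (fun j => e j (+) f j).
Proof.
move=> UU; rewrite /sign_mx.
rewrite (_ : diag_mx (\row_k (-1) ^+ (e k (+) f k)) =
  diag_mx (\row_k (-1) ^+ e k) *m diag_mx (\row_k (-1) ^+ f k)).
  by rewrite -!mulmxA (mulmxA U^T U) UU mul1mx.
rewrite mulmx_diag; congr diag_mx; apply/rowP => k; rewrite !mxE signr_addb//.
Qed.

(** The sign matrix is the product of the Householder reflections in those columns of [U] where [e]
    is true. *)
Lemma law_invariant_sign (U : 'M[R]_d) e : (1 < d)%N -> orthogonal_mx U ->
  law_invariant P s (sign_mx U e).
Proof.
move=> d1 UU; have UU' := mulmx1C UU.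
suff main (r : seq 'I_d) : uniq r -> law_invariant P s (sign_mx U (fun j =>
  (j \in r) && e j)).
  rewrite (_ : e = fun j => (j \in enum 'I_d) && e j);
    first exact/main/enum_uniq.
  by apply/funext => j; rewrite mem_enum.
elim: r => [_|k r IH /= /andP[kr ur]].
  rewrite /sign_mx (_ : \row_k _ = const_mx 1); last by apply/rowP => k;
    rewrite !mxE.
  by rewrite diag_const_mx mulmx1 UU'; exact: law_invariant1.
have [ek|ek] := boolP (e k); last first.
  rewrite (_ : (fun j => _) = fun j => (j \in r) && e j); first exact: IH.
  by apply/funext => j; rewrite in_cons; case: eqVneq => [->|//];
    rewrite (negbTE ek) !andbF.
rewrite (_ : sign_mx _ _ = householder (col k U) *m sign_mx U (fun j =>
  (j \in r) && e j)).
  apply: law_invariantM; last exact: IH.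
  apply: law_invariant_householder => //.
  by rewrite tr_col rowE colE mulmxA -(mulmxA _ U^T U) UU mulmx1 mul_delta_mx;
    apply/matrixP => i j; rewrite !mxE !ord1 !eqxx.
rewrite householder_col// sign_mxM//; congr sign_mx; apply/funext => j.
by rewrite in_cons; case: eqVneq => [->|//]; rewrite (negbTE kr) ek.
Qed.

(** The columns are transformed one after the other along a duplicate-free list, so none is
    transformed twice. [Q] may depend on the column because the two sign matrices alternate with the
    step. *)
Lemma gaussian_columns_mulmx (Q : K -> 'M[R]_d) Z :
  (forall k, law_invariant P s (Q k)) -> gaussian_columns P s Z ->
  gaussian_columns P s (fun i w => \sum_b Q i.1 i.2 b * Z (i.1, b) w : RT).
Proof.
move=> QI ZG.
suff main (r : seq K) : uniq r -> gaussian_columns P s (fun i w =>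
    if i.1 \in r then \sum_b Q i.1 i.2 b * Z (i.1, b) w else Z i w : RT).
  have := main _ (enum_uniq K); congr gaussian_columns.
  by apply/funext => i; apply/funext => w; rewrite mem_enum.
elim: r => [_|k r IH /= /andP[kr ur]]; first by congr gaussian_columns: ZG;
  apply/funext.
have := QI k _ k (IH ur); congr gaussian_columns.
apply/funext => -[l i]; apply/funext => w /=; rewrite in_cons.
by case: eqVneq => [->|//]; rewrite (negbTE kr).
Qed.

End sign_matrices.

(** * Uniqueness of the joint law of a Gaussian family *)

Section law_uniqueness.
Context {R : realType} {disp : measure_display} {T : measurableType disp}.
Variable P : probability T R.
Local Notation RT := (measurableTypeR R).
Variable I : finType.

Definition boxes : set (set (I -> R)) :=
  [set S | exists B : I -> set RT, (forall i, measurable (B i)) /\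
    S = [set z | forall i, B i (z i)]].

(** The product sigma-algebra, presented by a pi-system of generators so that two measures can be
    compared on boxes. *)
Definition sample_space : measurableType _ := g_sigma_algebraType boxes.

Lemma measurable_coord i :
  measurable_fun setT (fun z : sample_space => z i : RT).
Proof.
move=> _ A mA; rewrite setTI; apply: sub_sigma_algebra.
exists (fun j => if j == i then A else setT); split => [j|]; first by case: ifP.
apply/seteqP; split => z /= Az; first by move=> j; case: eqVneq => [->|].
by have := Az i; rewrite eqxx.
Qed.

(** Boxes are stable under intersection and include the whole space, and the two image measures
    agree on them. *)
Lemma gaussian_law_unique (s : I -> R) (Z Z' : I -> T -> RT) :
  gaussian_law P s Z -> gaussian_law P s Z' ->
  forall S : set sample_space, measurable S ->
  P [set w | S (Z^~ w)] = P [set w | S (Z'^~ w)].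
Proof.
move=> [mZ PZ] [mZ' PZ'] S mS.
have mf (Y : I -> T -> RT) : (forall i, measurable_fun setT (Y i)) ->
    measurable_fun setT (fun w => Y^~ w : sample_space).
  move=> mY; apply: (@measurability _ _ T sample_space setT (fun w =>
    Y^~ w) boxes erefl).
  move=> _ [_ [B [mB ->] <-]]; rewrite setTI.
  exact: (@measurable_forall _ _ _ _ Y B mY mB).
have [m mE] := pushforward_is_measure P (mf _ mZ).
have [m' mE'] := pushforward_is_measure P (mf _ mZ').
have -> : P [set w | S (Z^~ w)] = m S by rewrite mE.
have -> : P [set w | S (Z'^~ w)] = m' S by rewrite mE'.
have box_m B : (forall i, measurable (B i)) ->
    boxes [set z : I -> R | forall i, (B : I -> set RT) i (z i)].
  by move=> mB; exists B.
apply: (@g_sigma_algebra_measure_unique _ R sample_space boxes _ (fun _ =>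
  setT) _ _ m m' _ _ _ S) => //.
- by move=> A bA; exact: sub_sigma_algebra.
- move=> _; have := box_m (fun _ => setT) (fun _ => measurableT).
  by congr (boxes _); apply/seteqP.
- by rewrite bigcup_const//; exists 0%N.
- move=> _ _ [B [mB ->]] [B' [mB' ->]].
  have := box_m (fun i => B i `&` B' i) (fun i =>
    measurableI _ _ (mB i) (mB' i)).
  congr (boxes _); apply/seteqP; split => z /=.
    by move=> BB'; split => i; case: (BB' i).
  by move=> [Bz B'z] i; split.
- move=> _ [B [mB ->]]; rewrite mE mE'.
  by transitivity (\prod_i fine (normal_prob 0 (s i) (B i)))%:E;
    [exact: PZ|exact/esym/PZ'].
- move=> _; have -> : m setT = 1%E by rewrite mE; exact: (probability_setT P).
  exact: ltry.
Qed.
End law_uniqueness.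

(** * Rademacher sums *)

Section rademacher.
Context {R : realType}.

(* The optimal exponent is x ^+ 2 / 2; the constant only affects C. *)
Lemma expR_coshl (x : R) : expR x + expR (- x) <= 2 * expR (2 * x ^+ 2).
Proof.
(* For large [x], both exponents are at most [2 * x ^+ 2]. For small [x], [expR y <= (1 - y)^-1]
   bounds the sum by [2 / (1 - x ^+ 2)], and [(1 + 2 * x ^+ 2) * (1 - x ^+ 2) >= 1] holds when
   [x ^+ 2 <= 1/2]. *)
have [x2|x2] := leP (x ^+ 2) (2^-1); last first.
  have H (y : R) : y ^+ 2 = x ^+ 2 -> expR y <= expR (2 * x ^+ 2).
    move=> yx; rewrite ler_expR -yx; rewrite -yx in x2; nra.
  by rewrite mulr_natl mulr2n lerD// H// sqrrN.
have H (y : R) : y ^+ 2 <= 2^-1 -> expR y <= (1 - y)^-1.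
  move=> y2; have y1 : 0 < 1 - y by nra.
  rewrite -[expR y]invrK lef_pV2 ?posrE ?invr_gt0 ?expR_gt0// -expRN.
  exact: expR_ge1Dx.
apply: (@le_trans _ _ ((1 - x)^-1 + (1 + x)^-1)).
  by rewrite lerD ?H//; have := H (- x); rewrite opprK sqrrN; exact.
apply: (@le_trans _ _ (2 * (1 + 2 * x ^+ 2))); last first.
  by rewrite ler_wpM2l//; exact: expR_ge1Dx.
have y1 : 0 < 1 - x by nra.
have y2 : 0 < 1 + x by nra.
have -> : (1 - x)^-1 + (1 + x)^-1 = 2 / ((1 - x) * (1 + x)).
  by field; rewrite !lt0r_neq0.
rewrite ler_pM2l// -[leLHS]mul1r ler_pdivrMr ?mulr_gt0//.
by have := sqr_ge0 x; nra.
Qed.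

(** Independence of the signs: the sum over all sign vectors factors into a product of two-term
    sums, one for each [i]. *)
Lemma sum_expR_signs (I : finType) (a : I -> R) :
  \sum_(e : {ffun I -> bool}) expR (\sum_i (-1) ^+ e i * a i) <=
  2 ^+ #|I| * expR (2 * \sum_i a i ^+ 2).
Proof.
under eq_bigr do rewrite expR_sum.
rewrite -(bigA_distr_bigA (fun i (b : bool) => expR ((-1) ^+ b * a i))) /=.
rewrite mulr_sumr expR_sum -prodr_const -big_split/=.
apply: ler_prod => i _; rewrite big_bool /= expr1 expr0 mul1r mulN1r.
by rewrite addr_ge0 ?expR_ge0//= addrC expR_coshl.
Qed.

(** Chernoff bound in counting form: the left side counts sign vectors, and the extra factor 2 on
    the right accounts for the two tails. *)
Lemma rademacher_tail (I : finType) (a : I -> R) (v t : R) :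
  0 < v -> \sum_i a i ^+ 2 <= v -> 0 <= t ->
  \sum_(e : {ffun I -> bool}) (t < `|\sum_i (-1) ^+ e i * a i|)%R%:R <=
  2 ^+ #|I|.+1 * expR (- (t ^+ 2 / (8 * v))).
Proof.
(* This [l] minimizes [2 * l ^+ 2 * v - l * t]; the minimum is [- (t ^+ 2 / (8 * v))]. *)
move=> v0 av t0; pose l := t / (4 * v).
have l0 : 0 <= l by rewrite divr_ge0// mulr_ge0// ltW.
have side (b : R) : b ^+ 2 = 1 ->
    \sum_(e : {ffun I -> bool}) expR (\sum_i (-1) ^+ e i * (b * l * a i) - l *
      t) <=
    2 ^+ #|I| * expR (- (t ^+ 2 / (8 * v))).
  move=> b1; under eq_bigr do rewrite expRD.
  rewrite -mulr_suml; apply: (@le_trans _ _ (2 ^+ #|I| * expR (2 * (l ^+ 2 *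
    v)) * expR (- (l * t)))).
    rewrite ler_wpM2r ?expR_ge0//; apply: le_trans (sum_expR_signs _) _.
    rewrite ler_wpM2l ?exprn_ge0// ler_expR ler_wpM2l//.
    under eq_bigr do rewrite 2!exprMn b1 mul1r.
    by rewrite -mulr_sumr ler_wpM2l// sqr_ge0.
  rewrite -mulrA -expRD ler_wpM2l ?exprn_ge0// ler_expR le_eqVlt; apply/orP;
    left; apply/eqP.
  by rewrite /l; field; exact: lt0r_neq0.
rewrite exprS -mulrA mulr_natl mulr2n.
apply: le_trans (lerD (side 1 _) (side (-1) _));
  rewrite ?expr1n ?sqrrN ?expr1n//.
(* For each sign vector the indicator is at most the sum of the two exponentials: when the event
   occurs, the one matching the sign of [S] is at least 1. *)
rewrite -big_split/=; apply: ler_sum => e _.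
have Sl (b : R) : \sum_i (-1) ^+ e i * (b * l * a i) = b * l * \sum_i (-1) ^+ e
  i * a i.
  by rewrite mulr_sumr; apply: eq_bigr => i _; rewrite mulrCA.
rewrite !Sl; set S := \sum_i _.
have [tS|_] := ltP t `|S|; last by rewrite addr_ge0 ?expR_ge0.
have exp1 (x : R) : 0 <= x -> 1 <= expR x by move=> x0; rewrite -expR0 ler_expR.
case: (ger0P S) tS => S0 tS.
  by rewrite ler_wpDr ?expR_ge0// exp1// mul1r -mulrBr mulr_ge0// subr_ge0 ltW.
by rewrite ler_wpDl ?expR_ge0// exp1// mulN1r mulNr -mulrN -mulrBr mulr_ge0//
  subr_ge0 ltW.
Qed.
End rademacher.

(** * Gram-Schmidt and the noisy power method *)

Section gram_schmidt.
Context {R : realType} {d : nat}.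
Implicit Types (u v : 'cV[R]_d) (s : seq 'cV[R]_d) (Q : 'M[R]_d).

Lemma dotvE u v : dotv u v = (u^T *m v) 0 0.
Proof. by rewrite mxE; apply: eq_bigr => i _; rewrite mxE. Qed.

Lemma dotv_orthogonal Q u v : orthogonal_mx Q ->
  dotv (Q *m u) (Q *m v) = dotv u v.
Proof. by move=> QQ; rewrite !dotvE trmx_mul mulmxA -(mulmxA u^T) QQ mulmx1.
  Qed.

Lemma gs_step_orthogonal Q s v : orthogonal_mx Q ->
  gs_step (map (mulmx Q) s) (Q *m v) = map (mulmx Q) (gs_step s v).
Proof.
move=> QQ; rewrite /gs_step map_rcons big_map.
have -> : Q *m v - \sum_(x <- s) dotv (Q *m x) (Q *m v) *: (Q *m x) =
    Q *m (v - \sum_(x <- s) dotv x v *: x).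
  rewrite mulmxBr mulmx_sumr; congr (_ - _).
  by apply: eq_bigr => x _; rewrite dotv_orthogonal// scalemxAr.
by rewrite /norm2 dotv_orthogonal// scalemxAr.
Qed.

Lemma col_mulmx p Q (Y : 'M[R]_(d, p)) k : col k (Q *m Y) = Q *m col k Y.
Proof. by rewrite !colE mulmxA. Qed.

(** Gram-Schmidt is built from inner products, which [Q] preserves, and linear combinations, which
    commute with [Q]. *)
Lemma gram_schmidt_orthogonal p Q (Y : 'M[R]_(d, p)) : orthogonal_mx Q ->
  gram_schmidt (Q *m Y) = Q *m gram_schmidt Y.
Proof.
move=> QQ; apply/matrixP => i j; rewrite !mxE.
rewrite (eq_map (fun k => col_mulmx Q Y k)) (map_comp (mulmx Q) (fun k =>
  col k Y)).
have fold l s : foldl (@gs_step R d) (map (mulmx Q) s) (map (mulmx Q) l) =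
    map (mulmx Q) (foldl (@gs_step R d) s l).
  by elim: l s => //= y l IH s; rewrite gs_step_orthogonal// IH.
rewrite (fold _ [::]); set s := foldl _ _ _.
have -> : nth 0 (map (mulmx Q) s) j = Q *m nth 0 s j.
  have [js|js] := ltnP j (size s); first by rewrite (nth_map 0).
  by rewrite !nth_default ?size_map// mulmx0.
by rewrite mxE; apply: eq_bigr => k _; rewrite mxE.
Qed.

Lemma dotv_ge0 u : 0 <= dotv u u.
Proof. by apply: sumr_ge0 => i _; rewrite -expr2 sqr_ge0. Qed.

Lemma dotv_normalized_le1 u : dotv ((norm2 u)^-1 *: u) ((norm2 u)^-1 *: u) <= 1.
Proof.
have -> a : dotv (a *: u) (a *: u) = a ^+ 2 * dotv u u.
  by rewrite /dotv mulr_sumr; apply: eq_bigr => i _; rewrite !mxE; ring.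
rewrite exprVn sqr_sqrtr ?dotv_ge0//.
by have [->|u0] := eqVneq (dotv u u) 0; rewrite ?mulr0// mulVf.
Qed.

(** Stated as an inequality to cover dependent columns, which yield zero vectors; no argument about
    the rank of a random matrix is involved. *)
Lemma gram_schmidt_col_le1 p (Y : 'M[R]_(d, p)) j :
  \sum_i gram_schmidt Y i j ^+ 2 <= 1.
Proof.
have fold l s : (forall k, dotv (nth 0 s k) (nth 0 s k) <= 1) ->
    forall k, dotv (nth 0 (foldl (@gs_step R d) s l) k) (nth 0 (foldl (@gs_step
      R d) s l) k) <= 1.
  elim: l s => //= y l IH s s1; apply: IH => k.
  rewrite nth_rcons; case: ifP => // _; case: ifP => _.
    exact: dotv_normalized_le1.
  by rewrite /dotv big1// => i _; rewrite mxE mul0r.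
under eq_bigr do rewrite mxE expr2.
apply: (fold _ [::]) => k.
by rewrite nth_nil /dotv big1// => i _; rewrite mxE mul0r.
Qed.

Lemma measurable_gram_schmidt disp (T : measurableType disp) p
    (Y : T -> 'M[R]_(d, p)) :
  (forall i j, measurable_fun setT (fun w => Y w i j)) ->
  forall i j, measurable_fun setT (fun w => gram_schmidt (Y w) i j).
Proof.
move=> mY i j.
(* The length [n] of the list is the same for all [w], so the position tests made by [nth] do not
   depend on [w]. *)
have fold (l : seq 'I_p) (s : T -> seq 'cV[R]_d) n :
    (forall w, size (s w) = n) ->
    (forall k i, measurable_fun setT (fun w => nth 0 (s w) k i 0)) ->
    forall k i, measurable_fun setT
      (fun w => nth 0 (foldl (@gs_step R d) (s w) [seq col k (Y w) | k <- l]) k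
        i 0).
  elim: l s n => //= y l IH s n sn ms; apply: (IH _ n.+1) => [w|k {}i].
    by rewrite size_rcons sn.
  pose r w := col y (Y w) - \sum_(x <- s w) dotv x (col y (Y w)) *: x.
  have rE w a : r w a 0 = Y w a y - \sum_(m < n) (\sum_b nth 0 (s w) m b 0 * Y
    w b y) * nth 0 (s w) m a 0.
    rewrite /r !mxE (big_nth 0) sn big_mkord summxE; congr (_ - _).
    apply: eq_bigr => m _; rewrite !mxE; congr (_ * _).
    by apply: eq_bigr => b _; rewrite mxE.
  have mr a : measurable_fun setT (fun w => r w a 0).
    rewrite (funext (rE^~ a)); apply: measurable_funB => //.
    apply: measurable_sum => m; apply: measurable_funM => //.
    by apply: measurable_sum => b; apply: measurable_funM.
  have mnorm : measurable_fun setT (fun w => (norm2 (r w))^-1).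
    (* Inversion becomes a real power, known to be measurable; the two agree at 0 as well. *)
    rewrite (_ : (fun w => _) = (fun w => norm2 (r w) `^ (-1))); last first.
      by apply/funext => w; rewrite powR_inv1// sqrtr_ge0.
    apply: (measurableT_comp (measurable_powR (R := R) (-1))).
    apply: (measurableT_comp (continuous_measurable_fun (@sqrt_continuous R))).
    by apply: measurable_sum => b; apply: measurable_funM.
  rewrite (_ : (fun w => _) = fun w => if (k < n)%N then nth 0 (s w) k i 0
     else if k == n then (norm2 (r w))^-1 * r w i 0 else 0); last first.
    apply/funext => w; rewrite /gs_step nth_rcons sn; case: ifP => // _.
    by case: ifP => _; rewrite mxE.
  case: (ltnP k n) => _ //; case: (k == n) => //.
  exact: measurable_funM.
rewrite (_ : (fun w => _) = fun w =>
    nth 0 (foldl (@gs_step R d) [::] [seq col k (Y w) | k <- enum 'I_p]) j i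
      0); last first.
  by apply/funext => w; rewrite mxE.
apply: (fold _ (fun _ => [::]) 0%N) => // k {}i.
Qed.
End gram_schmidt.

Section noisy_power.
Context {R : realType} {d p : nat}.
Implicit Types (A Q U V : 'M[R]_d) (X : 'M[R]_(d, p)) (G : nat -> 'M[R]_(d, p)).

Lemma eq_noisy_power A X G H l : (forall k, (1 <= k <= l)%N -> G k = H k) ->
  noisy_power A X G l = noisy_power A X H l.
Proof.
elim: l => //= l IH GH; rewrite IH ?GH ?leqnn// => k /andP[k1 kl].
by rewrite GH// k1 leqW.
Qed.

(** The intertwining relation gives [A (Q k X) + Q k.+1 G = Q k.+1 (A X + G)], and Gram-Schmidt lets
    [Q k.+1] out. *)
Lemma noisy_power_orthogonal A X G (Q : nat -> 'M[R]_d) l :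
  (forall k, orthogonal_mx (Q k)) -> (forall k, Q k.+1 *m A = A *m Q k) ->
  noisy_power A (Q 0%N *m X) (fun k => Q k *m G k) l = Q l *m noisy_power A X G
    l.
Proof.
move=> QQ QA; elim: l => //= l ->.
by rewrite mulmxA -QA -mulmxA -mulmxDr gram_schmidt_orthogonal.
Qed.

Lemma measurable_noisy_power disp (T : measurableType disp) A
    (X : T -> 'M[R]_(d, p)) (G : nat -> T -> 'M[R]_(d, p)) l :
  (forall i j, measurable_fun setT (fun w => X w i j)) ->
  (forall k i j, (1 <= k <= l)%N -> measurable_fun setT (fun w => G k w i j)) ->
  forall i j, measurable_fun setT (fun w => noisy_power A (X w) (fun k =>
    G k w) l i j).
Proof.
move=> mX; elim: l => //= l IH mG; apply: measurable_gram_schmidt => i j.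
rewrite (_ : (fun w => _) = fun w =>
    \sum_k A i k * noisy_power A (X w) (fun k => G k w) l k j + G l.+1 w i j);
      last first.
  by apply/funext => w; rewrite !mxE.
apply: measurable_funD; last by apply: mG; rewrite leqnn.
apply: measurable_sum => k; apply: measurable_funM => //.
by apply: IH => m i' j' /andP[m1 ml]; apply: mG; rewrite m1 leqW.
Qed.

Lemma sign_mx_orthogonal U e : orthogonal_mx U -> orthogonal_mx (sign_mx U e).
Proof.
move=> UU; rewrite /orthogonal_mx.
have -> : (sign_mx U e)^T = sign_mx U e.
  by rewrite /sign_mx !trmx_mul trmxK tr_diag_mx mulmxA.
rewrite sign_mxM// /sign_mx (_ : \row_k _ = const_mx 1).
  by rewrite diag_const_mx mulmx1; exact: mulmx1C.
by apply/rowP => k; rewrite !mxE addbb.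
Qed.

(** After cancelling [U^T U] and [V^T V], only the commutation of two diagonal matrices remains. *)
Lemma svd_sign_mx A U S V e : is_svd A U S V ->
  sign_mx U e *m A = A *m sign_mx V e.
Proof.
move=> [UU VV _ Sd ->]; rewrite /sign_mx -!mulmxA (mulmxA U^T) UU mul1mx.
rewrite (mulmxA V^T V) VV mul1mx; congr (_ *m _); rewrite !mulmxA;
  congr (_ *m _).
apply/matrixP => i j; rewrite mul_diag_mx mul_mx_diag !mxE mulrC.
by have [->//|/Sd ->] := eqVneq i j; rewrite !(mulr0, mul0r).
Qed.

(** Exchanging [U] and [V] gives the second intertwining relation, from [sign_mx V e] to
    [sign_mx U e]. *)
Lemma svd_tr A U S V : A^T = A -> is_svd A U S V -> is_svd A V S U.
Proof.
move=> AT [UU VV S0 Sd AE]; split => //; rewrite -AT AE !trmx_mul trmxK mulmxA.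
congr (_ *m _ *m _); apply/matrixP => i j; rewrite mxE.
by have [->//|ij] := eqVneq i j; rewrite !Sd// eq_sym.
Qed.

Lemma mx_norm_entry m n (M : 'M[R]_(m, n)) i j : `|M i j| <= `|M|.
Proof.
rewrite [leRHS]/Num.Def.normr/= mx_normrE.
exact: (le_bigmax _ (fun ij : 'I_m * 'I_n => `|M ij.1 ij.2|) (i, j)).
Qed.

Lemma mx_norm_leP m n (M : 'M[R]_(m, n)) c : 0 <= c ->
  `|M| <= c <-> forall i j, `|M i j| <= c.
Proof.
move=> c0; split => [Mc i j|Mc]; first exact: le_trans (mx_norm_entry _ _ _) Mc.
by rewrite [leLHS]/Num.Def.normr/= mx_normrE (bigmax_le _ c0)//= => -[i j] _;
  exact: Mc.
Qed.

Lemma sign_mx_entry U X e i j : (sign_mx U e *m X) i j =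
  \sum_k (-1) ^+ e k * (U i k * (U^T *m X) k j).
Proof.
rewrite /sign_mx -!mulmxA mxE; apply: eq_bigr => k _.
by rewrite mul_diag_mx !mxE mulrCA.
Qed.

(** Bounds the variance of the Rademacher sum: each [U i k] is at most [|U|] in absolute value, and
    [U^T] preserves the norm of column [j]. *)
Lemma sum_sqr_entry_le U X i j : orthogonal_mx U -> \sum_k X k j ^+ 2 <= 1 ->
  \sum_k (U i k * (U^T *m X) k j) ^+ 2 <= `|U| ^+ 2.
Proof.
move=> UU X1; apply: (@le_trans _ _ (\sum_k `|U| ^+ 2 * (U^T *m X) k j ^+ 2)).
  apply: ler_sum => k _; rewrite exprMn ler_wpM2r ?sqr_ge0//.
  by rewrite -(real_normK (num_real (U i k))) ler_sqr ?nnegrE// mx_norm_entry.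
rewrite -mulr_sumr ler_piMr ?sqr_ge0//; apply: le_trans X1.
have UT : orthogonal_mx U^T by rewrite /orthogonal_mx trmxK; exact: mulmx1C.
have sq (M : 'M[R]_(d, p)) : \sum_k M k j ^+ 2 = dotv (col j M) (col j M).
  by apply: eq_bigr => k _; rewrite mxE expr2.
by rewrite !sq col_mulmx dotv_orthogonal.
Qed.

End noisy_power.

(** * Sums of probabilities as expected counts *)

Section probability_sums.
Context {R : realType} {disp : measure_display} {T : measurableType disp}.
Variable P : probability T R.

Lemma sum_probabilityE (E : finType) (S : E -> set T) :
  (forall e, measurable (S e)) ->
  (\sum_e P (S e) = \int[P]_w (\sum_e (\1_(S e) w)%:E))%E.
Proof.
move=> mS; rewrite ge0_integral_sum//; last by move=> e; exact/measurable_EFinP.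
by apply: eq_bigr => e _; rewrite integral_indic// setIT.
Qed.

(** Exchanges the sum over signs with the expectation: a bound on the number of events occurring at
    each outcome is integrated. *)
Lemma sum_probability_le (E : finType) (S : E -> set T) (c : R) :
  (forall e, measurable (S e)) -> (forall w, \sum_e \1_(S e) w <= c) ->
  (\sum_e P (S e) <= c%:E)%E.
Proof.
move=> mS Sc; rewrite sum_probabilityE//.
apply: (@le_trans _ _ (\int[P]_w (cst c%:E) w)%E).
  apply: ge0_le_integral => //.
  - by move=> w _; exact: sume_ge0.
  - by apply: emeasurable_sum => e; exact/measurable_EFinP.
  - by move=> w _; rewrite sumEFin lee_fin.
by rewrite integral_cst// [X in (_ * X)%E]probability_setT mule1.
Qed.

Lemma probability_le_sum (E : finType) (S : E -> set T) (A : set T) :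
  (forall e, measurable (S e)) -> measurable A ->
  (forall w, A w -> exists e, S e w) -> (P A <= \sum_e P (S e))%E.
Proof.
move=> mS mA AS; rewrite sum_probabilityE//.
rewrite -[A]setIT -integral_indic//; apply: ge0_le_integral => //.
- exact/measurable_EFinP.
- by apply: emeasurable_sum => e; exact/measurable_EFinP.
- move=> w _; rewrite sumEFin lee_fin [leLHS]indicE.
  have [/set_mem/AS[e Sw]|_] := boolP (w \in A); last by apply: sumr_ge0 =>
    e _; exact: ler0n.
  rewrite (bigD1 e)//= [in leRHS]indicE mem_set// lerDl.
  by apply: sumr_ge0 => e' _; rewrite indicE ler0n.
Qed.
End probability_sums.

Lemma orthogonal_norm_gt0 (R : realType) d (U : 'M[R]_d) :
  (0 < d)%N -> orthogonal_mx U -> 0 < `|U|.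
Proof.
move=> d0 UU; rewrite normr_gt0; apply: contraTneq isT => U0; move: UU.
rewrite /orthogonal_mx U0 trmx0 mul0mx.
by move=> /matrixP/(_ (Ordinal d0) (Ordinal d0))/eqP;
  rewrite !mxE eqxx eq_sym oner_eq0.
Qed.

Lemma measurable_norm_gt (R : realType) disp (T : measurableType disp)
    (f : T -> measurableTypeR R) (t : R) :
  measurable_fun setT f -> measurable [set w | (t < `|f w|)%R].
Proof.
move=> mf; have mg : measurable_fun setT (fun w => `|f w| : R).
  exact: (measurableT_comp (@normr_measurable R setT)).
have -> : [set w | (t < `|f w|)%R] = setT `&` (fun w => `|f w|) @^-1` `]t, +oo[.
  by rewrite setTI; apply/seteqP; split => w /=; rewrite in_itv/= andbT.
exact: mg.
Qed.

(** * Tail bound for a single entry of an iterate *)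

Section gaussian_noisy_power.
Context {R : realType} {disp : measure_display} {T : measurableType disp}.
Variable P : probability T R.
Local Notation RT := (measurableTypeR R).
Variables (d p L : nat) (A U V S : 'M[R]_d).
Hypotheses (A_sym : A^T = A) (A_svd : is_svd A U S V).
Local Notation K := ('I_L.+1 * 'I_p)%type.
Local Notation I := (K * 'I_d)%type.

(* Junk for l > L, where inord l = ord0. *)
Definition noise_mx (z : I -> R) (l : nat) : 'M[R]_(d, p) :=
  \matrix_(i, j) z (inord l, j, i).

(** A function of the sample point, so that events about it are subsets of [sample_space] and
    equality of laws applies to them. *)
Definition power_process (z : I -> R) (l : nat) : 'M[R]_(d, p) :=
  noisy_power A (gram_schmidt (noise_mx z 0)) (noise_mx z) l.

Lemma measurable_power_process disp' (T' : measurableType disp')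
    (Y : I -> T' -> RT) l i j :
  (forall k, measurable_fun setT (Y k)) ->
  measurable_fun setT (fun w => power_process (Y^~ w) l i j : RT).
Proof.
move=> mY; have mN k a b : measurable_fun setT (fun w =>
  noise_mx (Y^~ w) k a b).
  rewrite (_ : (fun w => _) = Y (inord k, b, a)); first exact: mY.
  by apply/funext => w; rewrite mxE.
apply: measurable_noisy_power => [a b|k a b _]; last exact: mN.
exact: measurable_gram_schmidt.
Qed.

Lemma power_process_orthogonal (Q : nat -> 'M[R]_d) (z : I -> R) l :
  (forall k, orthogonal_mx (Q k)) -> (forall k, Q k.+1 *m A = A *m Q k) ->
  (l <= L)%N ->
  power_process (fun i => \sum_b Q i.1.1 i.2 b * z (i.1, b)) l =
  Q l *m power_process z l.
Proof.
move=> QQ QA lL; rewrite -noisy_power_orthogonal// -gram_schmidt_orthogonal//.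
have NQ k : (k <= L)%N ->
    noise_mx (fun i => \sum_b Q i.1.1 i.2 b * z (i.1,
      b)) k = Q k *m noise_mx z k.
  move=> kL; apply/matrixP => i j; rewrite !mxE /= inordK ?ltnS//.
  by apply: eq_bigr => b _; rewrite mxE.
rewrite /power_process NQ//; apply: eq_noisy_power => k /andP[_ kl].
by rewrite NQ// (leq_trans kl).
Qed.

Lemma power_process_col_le1 (z : I -> R) l j : (0 < l)%N ->
  \sum_i power_process z l i j ^+ 2 <= 1.
Proof. by case: l => // l _; exact: gram_schmidt_col_le1. Qed.

Lemma power_process_tail (s : K -> R) (Z : I -> T -> RT) l i j t :
  (1 < d)%N -> (0 < l <= L)%N -> (forall k, s k != 0) ->
  gaussian_columns P s Z -> 0 <= t ->
  (P [set w | (t < `|power_process (Z^~ w) l i j|)%R] <=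
   (2 * expR (- (t ^+ 2 / (8 * `|U| ^+ 2))))%:E)%E.
Proof.
move=> d1 /andP[l0 lL] s0 ZG t0.
have [UU VV _ _ _] := A_svd.
(* The parity is counted from [l], so that step [l] itself uses [U], whose entries then appear in
   the Rademacher sum. *)
pose Q (e : {ffun 'I_d -> bool}) k := sign_mx (if odd k == odd l then U else V)
  e.
have QQ e k : orthogonal_mx (Q e k) by apply: sign_mx_orthogonal; case: ifP.
have QA e k : Q e k.+1 *m A = A *m Q e k.
  have HU := svd_sign_mx e A_svd; have HV := svd_sign_mx e (svd_tr A_sym A_svd).
  by rewrite /Q /=; case: (odd k); case: (odd l).
pose F z := power_process z l i j.
pose E := [set z : sample_space (R := R) I | (t < `|F z|)%R].
have mE : measurable E.
  apply: measurable_norm_gt; apply: measurable_power_process => k.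
  exact: measurable_coord.
have QZ e : gaussian_columns P s (fun k w => \sum_b Q e k.1.1 k.2 b * Z (k.1,
  b) w : RT).
  apply: (gaussian_columns_mulmx (Q := fun k : K => Q e k.1)) => // k.
  by apply: law_invariant_sign => //; case: ifP.
pose Ee (e : {ffun 'I_d -> bool}) := [set w | (t < `|\sum_k (-1) ^+ e k * (U i
  k * (U^T *m power_process (Z^~ w) l) k j)|)%R].
have FQ e w : F (fun k => \sum_b Q e k.1.1 k.2 b * Z (k.1, b) w) =
    \sum_k (-1) ^+ e k * (U i k * (U^T *m power_process (Z^~ w) l) k j).
  by rewrite /F (power_process_orthogonal (Z^~ w) (QQ e) (QA e) lL) /Q eqxx
    sign_mx_entry.
(* The transformed family has the same law as [Z], so this probability does not depend on [e]. *)
have PEe e : P (Ee e) = P [set w | (t < `|F (Z^~ w)|)%R].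
  rewrite (gaussian_law_unique ZG (QZ e) mE); congr (P _).
  by apply/seteqP; split => w; rewrite /E/= FQ.
have mF : measurable_fun setT (fun w => F (Z^~ w) : RT).
  by apply: measurable_power_process; case: ZG.
have mEe e : measurable (Ee e).
  rewrite (_ : Ee e = [set w | (t < `|F (fun k =>
    \sum_b Q e k.1.1 k.2 b * Z (k.1, b) w)|)%R]).
    by apply: measurable_norm_gt; apply: measurable_power_process; case: (QZ e).
  by apply/seteqP; split => w; rewrite /= FQ.
have v0 : 0 < `|U| ^+ 2 by rewrite exprn_gt0// orthogonal_norm_gt0// ltnW.
set x := expR _; pose c := 2 ^+ #|'I_d|.+1 * x.
have : (\sum_(e : {ffun 'I_d -> bool}) P (Ee e) <= c%:E)%E.
  apply: sum_probability_le => // w.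
  under eq_bigr do rewrite indicE.
  apply: le_trans (rademacher_tail v0 (sum_sqr_entry_le i UU
    (power_process_col_le1 (Z^~ w) j l0)) t0).
  by apply: ler_sum => e _; case: (boolP (w \in Ee e)) => [/set_mem/= ->|_];
    rewrite ?ler0n.
(* The left side is now [2 ^ d] copies of one probability; dividing leaves the factor 2. *)
rewrite (eq_bigr _ (fun e _ => PEe e)) -(@fineK _ (P _)); last first.
  by apply: fin_num_measure; exact: (measurable_norm_gt _ mF).
rewrite sumEFin !lee_fin sumr_const card_ffun card_bool /c exprS -(mulr_natl
  (fine _)).
rewrite natrX -mulrA mulrCA ler_pM2l ?exprn_gt0//.
Qed.
End gaussian_noisy_power.

(** A reindexing: step and matrix column together form the column index, and the matrix row becomes
    the coordinate. *)
Lemma gaussian_family_columns (R : realType) (disp : measure_display)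
    (T : measurableType disp) (P : probability T R) (d p L : nat)
    (W : 'I_d -> 'I_p -> {RV P >-> R})
    (G : nat -> 'I_d -> 'I_p -> {RV P >-> R}) (sigma : nat -> R) :
  (forall i j, normal_rv 0 1 (W i j)) ->
  (forall l i j, (1 <= l <= L)%N -> normal_rv 0 (sigma l) (G l i j)) ->
  mutually_independent (gaussian_family (L := L) W G) ->
  gaussian_columns P (fun k : 'I_L.+1 * 'I_p =>
    if k.1 == 0%N :> nat then 1 else sigma k.1)
    (fun i w => gaussian_family W G (i.1.1, i.2, i.1.2) w : measurableTypeR R).
Proof.
move=> WN GN ind; split=> [i|B mB]; first exact: (measurable_funP
  (gaussian_family W G _)).
pose h (i : 'I_L.+1 * 'I_p * 'I_d) := (i.1.1, i.2, i.1.2).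
have hK : cancel h (fun k => (k.1.1, k.2, k.1.2)) by case=> -[].
have hK' : cancel (fun k : 'I_L.+1 * 'I_d * 'I_p => (k.1.1, k.2,
  k.1.2)) h by case=> -[].
have := ind [set: _]%SET (fun k => B (k.1.1, k.2, k.1.2)) (fun k _ => mB _).
have -> : [set w | forall k, k \in [set: 'I_L.+1 * 'I_d * 'I_p]%SET ->
    B (k.1.1, k.2, k.1.2) (gaussian_family W G k w)] =
    [set w | forall i, B i (gaussian_family W G (i.1.1, i.2, i.1.2) w)].
  apply/seteqP; split => w /= Bw => [[[l j] i]|[[l i] j] _].
    by apply: (Bw (l, i, j)); rewrite finset.in_setT.
  exact: (Bw (l, j, i)).
move=> ->; congr EFin; rewrite (reindex h)/=; last first.
  by exists (fun k => (k.1.1, k.2, k.1.2)) => k _; [exact: hK|exact: hK'].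
apply: eq_big => [k|[[l j] i] _]; first by rewrite finset.in_setT.
congr fine; rewrite /h/=; have := mB (l, j, i); move: (B _) => {}B {}mB.
case: ifPn => l0; first exact: WN.
have lL : (1 <= l <= L)%N by rewrite lt0n l0 -ltnS /=.
exact: (GN l i j lL B mB).
Qed.

Theorem theorem4p9 (R : realType) :
  exists C : R, 0 < C /\
  forall (d p L : nat) (A U Sigma V : 'M[R]_d)
    (disp : measure_display) (T : measurableType disp) (P : probability T R)
    (W : 'I_d -> 'I_p -> {RV P >-> R})
    (G : nat -> 'I_d -> 'I_p -> {RV P >-> R})
    (sigma : nat -> R),
  (0 < d)%N -> (p <= d)%N -> (L <= d)%N ->
  A^T = A ->
  is_svd A U Sigma V ->
  (forall l, (1 <= l <= L)%N -> 0 < sigma l) ->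
  (forall i j, normal_rv 0 1 (W i j)) ->
  (forall l i j, (1 <= l <= L)%N -> normal_rv 0 (sigma l) (G l i j)) ->
  mutually_independent (gaussian_family (L := L) W G) ->
  let X (l : nat) (w : T) : 'M[R]_(d, p) :=
    noisy_power A (gram_schmidt (sample_mx W w)) (fun k => sample_mx (G k) w) l
  in
  ((1 - d%:R^-1)%:E <=
    P [set w | (\big[Num.max/0]_(1 <= l < L.+1) `|X l w| ^+ 2 <=
                C * (coherence U V * ln d%:R / d%:R))%R])%E.
Proof.
(* 40 is 8 times 5: 8 comes from the Rademacher tail, and the exponent [5 * ln d] turns each tail
   into [2 / d ^ 5]. *)
exists 40; split => // d p L A U S V disp T P W G sigma d0 pd Ld AT svd sigma0
  WN GN ind.
cbv zeta; pose X (l : nat) (w : T) : 'M[R]_(d, p) :=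
  noisy_power A (gram_schmidt (sample_mx W w)) (fun k => sample_mx (G k) w) l.
set c := 40 * _.
suff : ((1 - d%:R^-1)%:E <= P [set w | (\big[Num.max/0]_(1 <= l < L.+1) `|X l
  w| ^+ 2 <= c)%R])%E by [].
(* For [d = 1] the claimed lower bound is 0. *)
have [d1|d1] := leqP d 1.
  have dE : d = 1%N by apply/eqP; rewrite eqn_leq d1 d0.
  by apply: (le_trans _ (measure_ge0 _ _)); rewrite dE invr1 subrr.
pose s (k : 'I_L.+1 * 'I_p) := if k.1 == 0%N :> nat then 1 else sigma k.1.
have s0 k : s k != 0.
  rewrite /s; case: ifPn => [_|k0]; first exact: oner_neq0.
  by rewrite gt_eqF// sigma0// lt0n k0 -ltnS /=.
pose Z (i : 'I_L.+1 * 'I_p * 'I_d) w : measurableTypeR R :=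
  gaussian_family W G (i.1.1, i.2, i.1.2) w.
have ZG : gaussian_columns P s Z by exact: gaussian_family_columns WN GN ind.
have XE l w : (l <= L)%N -> X l w = power_process A (Z^~ w) l.
  move=> lL; have N0 : noise_mx (Z^~ w) 0 = sample_mx W w.
    by apply/matrixP => i j; rewrite !mxE /Z /gaussian_family/= inordK.
  rewrite /X /power_process N0; apply: eq_noisy_power => k /andP[k0 kl].
  apply/matrixP => i j; rewrite !mxE /Z /gaussian_family/= inordK ?ltnS
    ?(leq_trans kl)//.
  by rewrite gtn_eqF.
have dR : 1 < d%:R :> R by rewrite ltr1n.
have lnd : 0 < ln (d%:R : R) by exact: ln_gt0.
have coh : d%:R * `|U| ^+ 2 <= coherence U V by rewrite le_max lexx.
have coh0 : 0 <= coherence U V by apply: le_trans coh;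
  rewrite mulr_ge0 ?sqr_ge0.
have c0 : 0 <= c by rewrite mulr_ge0// divr_ge0// mulr_ge0// ltW.
pose t : R := Num.sqrt c; have t0 : 0 <= t by exact: sqrtr_ge0.
have t2 : t ^+ 2 = c by exact: sqr_sqrtr.
(* Ordinals start at 0 and the steps at 1, hence the successor. *)
pose bad (k : 'I_L * 'I_d * 'I_p) := [set w | (t < `|power_process A (Z^~ w)
  k.1.1.+1 k.1.2 k.2|)%R].
have mbad k : measurable (bad k).
  by apply: measurable_norm_gt; apply: measurable_power_process; case: ZG.
have goodE : [set w | (\big[Num.max/0]_(1 <= l < L.+1) `|X l w| ^+ 2 <= c)%R] =
    [set w | forall k, (~` bad k) w].
  have leE x : 0 <= x -> (x ^+ 2 <= c) = (x <= t).
    by move=> x0; rewrite -(sqr_sqrtr c0) ler_sqr ?nnegrE.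
  apply/seteqP; split => w /=; rewrite big_add1 big_mkord.
    move=> /bigmax_leP[_ Xc] k; apply/negP; rewrite -leNgt -XE//.
    by move: k.1.2 k.2; apply/mx_norm_leP => //; rewrite -leE//; exact: Xc.
  move=> Xt; apply/bigmax_leP; split => // l _; rewrite leE//.
  apply/mx_norm_leP => // i j; rewrite XE// leNgt; apply/negP.
  exact: (Xt (l, i, j)).
have mgood : measurable [set w | forall k, (~` bad k) w].
  rewrite (_ : [set w | _] = \bigcap_(k in [set: 'I_L * 'I_d * 'I_p]) ~` bad k).
    apply: fin_bigcap_measurable; first exact: finite_finset.
    by move=> k _; exact: measurableC.
  by apply/seteqP; split => w /= H k; [move=> _|]; exact: H.
rewrite goodE; set good := [set w | _].
have Pbad k : (P (bad k) <= (2 * d%:R^-1 ^+ 5)%:E)%E.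
  have [UU _ _ _ _] := svd.
  have v0 : 0 < `|U| ^+ 2 by rewrite exprn_gt0// orthogonal_norm_gt0.
  have kL : (0 < k.1.1.+1 <= L)%N by rewrite /= ltn_ord.
  apply: le_trans (power_process_tail AT svd k.1.2 k.2 d1 kL s0 ZG t0) _.
  rewrite lee_fin ler_pM2l// -{1}[d%:R]lnK ?posrE ?ltr0n// -expRN -expRM_natl
    ler_expR.
  have v8 : 0 < 8 * `|U| ^+ 2 by rewrite pmulr_rgt0.
  rewrite mulrN lerN2 ler_pdivlMr// t2 /c.
  have -> : 40 * (coherence U V * ln d%:R / d%:R) =
      40 * ln d%:R * (coherence U V / d%:R) by ring.
  have := ltW lnd.
  (* With this bound, [c] is at least [40 * ln d * |U| ^+ 2], so the exponent is at least
     [5 * ln d]. *)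
  have : `|U| ^+ 2 <= coherence U V / d%:R by rewrite ler_pdivlMr ?ltr0n//
    mulrC.
  nra.
have : (P (~` good) <= \sum_k P (bad k))%E.
  apply: probability_le_sum => //; first exact: measurableC.
  by move=> w /existsNP[k /contrapT]; exists k.
move=> /le_trans/(_ (lee_sum _ (fun k _ => Pbad k))).
rewrite sumEFin probability_setC// -(@fineK _ (P good)) ?fin_num_measure//.
rewrite -EFinB !lee_fin sumr_const !card_prod !card_ord => Pgood.
(* At most [d ^ 3] bad events give a total of at most [2 / d ^ 2], which is at most [1 / d] since
   [d >= 2]. *)
suff : 2 * d%:R^-1 ^+ 5 *+ (L * d * p) <= d%:R^-1 :> R by lra.
have Ldp : (L * d * p <= d ^ 3)%N by rewrite !expnS expn0 muln1 mulnA !leq_mul.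
rewrite -mulr_natr; apply: (@le_trans _ _ (2 * d%:R^-1 ^+ 5 * d%:R ^+ 3)).
  by rewrite -natrX ler_wpM2l ?ler_nat// mulr_ge0// exprn_ge0// invr_ge0.
have dn0 : d%:R != 0 :> R by rewrite gt_eqF// (lt_trans _ dR).
have -> : 2 * d%:R^-1 ^+ 5 * d%:R ^+ 3 = 2 / d%:R * d%:R^-1 :> R by field.
by rewrite ler_piMl ?invr_ge0// ler_pdivrMr ?ltr0n// mul1r ler_nat.
Qed.
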